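(* Let $S$ be a TOAST type that is well-formed against the initial valuation $\nu_0$. Then the system $(\nu_0, S, \emptyset) \mid (\nu_0, \overline{S}, \emptyset)$ satisfies progress.
   Context: Clocks and constraints. $\mathcal{X}$ is a finite set of clocks. A valuation is a map $\nu:\mathcal{X}\to\mathbb{R}_{\ge 0}$; $\nu_0$ maps every clock to $0$; $(\nu+t)(x)=\nu(x)+t$; for $\lambda\subseteq\mathcal{X}$, $\nu[\lambda\mapsto 0]$ sets the clocks in $\lambda$ to $0$ and leaves the others unchanged. Clock constraints are $\delta ::= \mathrm{true} \mid x>n \mid x=n \mid x-y>n \mid x-y=n \mid \neg\delta \mid \delta_1\wedge\delta_2$ with $n\in\mathbb{N}$. The past $\downarrow\delta$ is a constraint with $\nu\models\downarrow\delta$ iff $\exists t\ge 0.\ \nu+t\models\delta$. For a constraint $\delta$ and $\lambda\subseteq\mathcal X$, $\delta[\lambda\mapsto 0]\models\gamma$ means that $\nu[\lambda\mapsto0]\models\gamma$ whenever $\nu\models\delta$. Types (TOAST). $S ::= \{c_i\, l_i\langle T_i\rangle(\delta_i,\lambda_i).S_i\}_{i\in I} \mid \mu\alpha.S \mid \alpha \mid \mathrm{end}$, where $I\neq\emptyset$, $c_i\in\{!,?\}$ (send/receive), labels $l_i$ pairwise distinct, $\delta_i$ a clock constraint, $\lambda_i\subseteq\mathcal X$ a set of clocks to reset, and $T_i$ a payload type: either a base sort (nat, bool, string, none, ...) or a delegated session $(\delta',S')$. Recursion is contractive. The dual $\overline{S}$ is defined by $\overline{\mathrm{end}}=\mathrm{end}$,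 $\overline{\mu\alpha.S}=\mu\alpha.\overline S$, $\overline\alpha=\alpha$, and $\overline{\{c_i l_i\langle T_i\rangle(\delta_i,\lambda_i).S_i\}_{i\in I}}=\{\overline{c_i} l_i\langle T_i\rangle(\delta_i,\lambda_i).\overline{S_i}\}_{i\in I}$ with $\overline{!}=?$, $\overline{?}=!$. Well-formedness. Judgements $A;\delta\vdash S$, with $A$ a finite map from recursion variables to constraints, are generated by: (end) $A;\mathrm{true}\vdash\mathrm{end}$; (rec) $A;\delta\vdash\mu\alpha.S$ if $A,\alpha:\delta;\delta\vdash S$; (var) $A,\alpha:\delta;\delta\vdash\alpha$; (choice) $A;\downarrow(\bigvee_{i\in I}\delta_i)\vdash\{c_i l_i\langle T_i\rangle(\delta_i,\lambda_i).S_i\}_{i\in I}$ provided (feasibility) for every $i\in I$ there is $\gamma_i$ with $A;\gamma_i\vdash S_i$ and $\delta_i[\lambda_i\mapsto0]\models\gamma_i$; (mixed-choice) for all $i\neq j$ in $I$, $\delta_i\wedge\delta_j\models\mathrm{false}$ or $c_i=c_j$; (delegation) for every $i$ with $T_i=(\delta',S')$ there is $\gamma'$ with $\emptyset;\gamma'\vdash S'$ and $\delta'\models\gamma'$. $S$ is well-formed against $\nu$ (equivalently, configuration $(\nu,S)$ is well-formed) if there is $\delta$ with $\emptyset;\delta\vdash S$ and $\nu\models\delta$. Semantics. Messages are $m=l\langle T\rangle$; labels are $\ell ::= !m \mid ?m \mid \tau \mid t$ ($t\in\mathbb{R}_{\ge0}$). Configurations $(\nu,S)$: (act) $(\nu,\{c_i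 l_i\langle T_i\rangle(\delta_i,\lambda_i).S_i\}_{i\in I})\xrightarrow{c_j l_j\langle T_j\rangle}(\nu[\lambda_j\mapsto0],S_j)$ if $j\in I$ and $\nu\models\delta_j$; (unfold) $(\nu,\mu\alpha.S)\xrightarrow{\ell}C'$ if $(\nu,S[\mu\alpha.S/\alpha])\xrightarrow{\ell}C'$; (tick) $(\nu,S)\xrightarrow{t}(\nu+t,S)$. $(\nu,S)$ is future-enabled if there are $t,c,m$ with $(\nu,S)\xrightarrow{t}\xrightarrow{c\,m}$. Configurations with queues $(\nu,S,M)$, where $M$ is a FIFO queue of messages ($M::=\emptyset\mid m;M$, head first): (send) $(\nu,S,M)\xrightarrow{!m}(\nu',S',M)$ if $(\nu,S)\xrightarrow{!m}(\nu',S')$; (recv) $(\nu,S,m;M)\xrightarrow{\tau}(\nu',S',M)$ if $(\nu,S)\xrightarrow{?m}(\nu',S')$; (que) $(\nu,S,M)\xrightarrow{?m}(\nu,S,M;m)$; (time) $(\nu,S,M)\xrightarrow{t}(\nu',S',M)$ if $(\nu,S)\xrightarrow{t}(\nu',S')$, and if $(\nu,S)$ is future-enabled then so is $(\nu',S')$, and for all $t'<t$, $(\nu+t',S,M)$ has no $\tau$-transition. Systems $C_1\mid C_2$ of two configurations with queues: (com-l) $C_1\mid C_2\xrightarrow{\tau}C_1'\mid C_2'$ if $C_1\xrightarrow{!m}C_1'$ and $C_2\xrightarrow{?m}C_2'$, and symmetric (com-r); (par-l) $C_1\mid C_2\xrightarrow{\tau}C_1'\mid C_2$ if $C_1\xrightarrow{\tau}C_1'$,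 and symmetric (par-r); (wait) $C_1\mid C_2\xrightarrow{t}C_1'\mid C_2'$ if $C_1\xrightarrow{t}C_1'$ and $C_2\xrightarrow{t}C_2'$. Progress. $(\nu,S,M)$ is final if $S$ is equivalent to $\mathrm{end}$ up to unfolding of recursion (e.g. $\mu\alpha_1.\cdots\mu\alpha_k.\mathrm{end}$) and $M=\emptyset$. A system satisfies progress if for every system $C_1'\mid C_2'$ reachable from it by finitely many system transitions, either both $C_1'$ and $C_2'$ are final, or there is $t\in\mathbb{R}_{\ge0}$ with $C_1'\mid C_2'\xrightarrow{t}\xrightarrow{\tau}$. *)

(* Defs.v *)
From Stdlib Require Export Relation_Operators.
From mathcomp Require Export all_boot all_order all_algebra.
From mathcomp Require Export reals interval_inference.

Set Implicit Arguments.
Unset Strict Implicit.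
Unset Printing Implicit Defensive.

Import Order.TTheory GRing.Theory Num.Theory.
Local Open Scope ring_scope.

Section Constraints.
Variable X : finType.

Inductive constr : Type :=
| CTrue
| CGt (x : X) (n : nat)
| CEq (x : X) (n : nat)
| CDiffGt (x y : X) (n : nat)
| CDiffEq (x y : X) (n : nat)
| CNot (d : constr)
| CAnd (d1 d2 : constr).

Definition CFalse : constr := CNot CTrue.
Definition COr (d1 d2 : constr) : constr := CNot (CAnd (CNot d1) (CNot d2)).

Variable R : realType.

Definition valuation : Type := X -> {nonneg R}.

Definition nu0 : valuation := fun=> 0%:nng.

Definition delay (nu : valuation) (t : {nonneg R}) : valuation :=
  fun x => ((nu x)%:num + t%:num)%:nng.

Definition reset (lam : {set X}) (nu : valuation) : valuation :=
  fun x => if x \in lam then 0%:nng else nu x.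

Fixpoint sat (nu : valuation) (d : constr) : bool :=
  match d with
  | CTrue => true
  | CGt x n => n%:R < (nu x)%:num
  | CEq x n => (nu x)%:num == n%:R
  | CDiffGt x y n => n%:R < (nu x)%:num - (nu y)%:num
  | CDiffEq x y n => (nu x)%:num - (nu y)%:num == n%:R
  | CNot d => ~~ sat nu d
  | CAnd d1 d2 => sat nu d1 && sat nu d2
  end.

Definition entails (d g : constr) : Prop :=
  forall nu : valuation, sat nu d -> sat nu g.

Definition reset_entails (d : constr) (lam : {set X}) (g : constr) : Prop :=
  forall nu : valuation, sat nu d -> sat (reset lam nu) g.

(* The past of [d] is characterised by its satisfaction, hence determined up to
   logical equivalence; one always exists, by quantifier elimination (negative
   difference bounds [x - y > -n] are expressed as [~ (y - x >= n)]). *)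
Definition is_past (g d : constr) : Prop :=
  forall nu : valuation, sat nu g <-> exists t, sat (delay nu t) d.

End Constraints.

Arguments CTrue {X}.
Arguments CFalse {X}.
Arguments nu0 {X R}.

Inductive polarity : Type := Send | Recv.

Definition dual_pol (c : polarity) : polarity :=
  match c with Send => Recv | Recv => Send end.

Section Types.
Variables (X : finType) (L B : Type).

(* [L] is the set of message labels and [B] the set of base sorts.  A choice is
   indexed by the nonempty finite set 'I_n.+1; recursion variables are named by
   natural numbers. *)
Inductive stype : Type :=
| TEnd
| TVar (a : nat)
| TRec (a : nat) (S : stype)
| TChoice (n : nat)
    (c : 'I_n.+1 -> polarity) (l : 'I_n.+1 -> L) (T : 'I_n.+1 -> payload)
    (d : 'I_n.+1 -> constr X) (lam : 'I_n.+1 -> {set X})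
    (S : 'I_n.+1 -> stype)
with payload : Type :=
| PBase (b : B)
| PDeleg (d : constr X) (S : stype).

(* Every free occurrence of [a] in [S] lies under a choice. *)
Fixpoint guarded (a : nat) (S : stype) : bool :=
  match S with
  | TVar b => b != a
  | TRec b S1 => (b == a) || guarded a S1
  | TEnd | TChoice _ _ _ _ _ _ _ => true
  end.

(* The side conditions of the grammar of types: labels of a choice are pairwise
   distinct and recursion is contractive, also inside delegated sessions. *)
Fixpoint toast (S : stype) : Prop :=
  match S with
  | TEnd | TVar _ => True
  | TRec a S1 => guarded a S1 /\ toast S1
  | TChoice n c l T d lam S1 =>
      [/\ injective l, forall i, toast_payload (T i) & forall i, toast (S1 i)]
  end
with toast_payload (T : payload) : Prop :=
  match T with
  | PBase _ => True
  | PDeleg _ S1 => toast S1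
  end.

Fixpoint dual (S : stype) : stype :=
  match S with
  | TEnd => TEnd
  | TVar a => TVar a
  | TRec a S1 => TRec a (dual S1)
  | TChoice n c l T d lam S1 =>
      TChoice (fun i => dual_pol (c i)) l T d lam (fun i => dual (S1 i))
  end.

(* [subst a U S] is S[U/a].  There is no renaming of bound variables, so this is
   capture-avoiding only for closed [U]; well-formed configurations are closed
   and stay closed, so the unfolding rule only ever substitutes closed types. *)
Fixpoint subst (a : nat) (U : stype) (S : stype) : stype :=
  match S with
  | TEnd => TEnd
  | TVar b => if b == a then U else TVar b
  | TRec b S1 => TRec b (if b == a then S1 else subst a U S1)
  | TChoice n c l T d lam S1 =>
      TChoice c l (fun i => subst_payload a U (T i)) d lam
        (fun i => subst a U (S1 i))
  end
with subst_payload (a : nat) (U : stype) (T : payload) : payload :=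
  match T with
  | PBase b => PBase b
  | PDeleg d S1 => PDeleg d (subst a U S1)
  end.

Definition env : Type := seq (nat * constr X).

Fixpoint lookup (A : env) (a : nat) : option (constr X) :=
  match A with
  | [::] => None
  | (b, d) :: A => if b == a then Some d else lookup A a
  end.

Variable R : realType.

Inductive wf : env -> constr X -> stype -> Prop :=
| wf_end A : wf A CTrue TEnd
| wf_rec A d a S : wf ((a, d) :: A) d S -> wf A d (TRec a S)
| wf_var A d a : lookup A a = Some d -> wf A d (TVar a)
| wf_choice A (past : constr X) n
    (c : 'I_n.+1 -> polarity) (l : 'I_n.+1 -> L) (T : 'I_n.+1 -> payload)
    (d : 'I_n.+1 -> constr X) (lam : 'I_n.+1 -> {set X})
    (S : 'I_n.+1 -> stype) (g : 'I_n.+1 -> constr X) :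
    is_past R past (\big[@COr X/CFalse]_(i < n.+1) d i) ->
    (* feasibility *)
    (forall i, wf A (g i) (S i)) ->
    (forall i, reset_entails R (d i) (lam i) (g i)) ->
    (* mixed-choice *)
    (forall i j, i <> j -> entails R (CAnd (d i) (d j)) CFalse \/ c i = c j) ->
    (* delegation *)
    (forall i, wf_payload (T i)) ->
    wf A past (TChoice c l T d lam S)
with wf_payload : payload -> Prop :=
| wf_base b : wf_payload (PBase b)
| wf_deleg d S g : wf [::] g S -> entails R d g -> wf_payload (PDeleg d S).

Definition well_formed (nu : valuation X R) (S : stype) : Prop :=
  exists d, wf [::] d S /\ sat nu d.

Definition msg : Type := (L * payload)%type.

Inductive act_label : Type :=
| Comm (c : polarity) (m : msg)
| Tau
| Time (t : {nonneg R}).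

Definition config : Type := (valuation X R * stype)%type.

Inductive cstep : config -> act_label -> config -> Prop :=
| cstep_act nu n
    (c : 'I_n.+1 -> polarity) (l : 'I_n.+1 -> L) (T : 'I_n.+1 -> payload)
    (d : 'I_n.+1 -> constr X) (lam : 'I_n.+1 -> {set X})
    (S : 'I_n.+1 -> stype) (j : 'I_n.+1) :
    sat nu (d j) ->
    cstep (nu, TChoice c l T d lam S) (Comm (c j) (l j, T j))
      (reset (lam j) nu, S j)
| cstep_unfold nu a S ell C' :
    cstep (nu, subst a (TRec a S) S) ell C' -> cstep (nu, TRec a S) ell C'
| cstep_tick nu S t : cstep (nu, S) (Time t) (delay nu t, S).

Definition future_enabled (C : config) : Prop :=
  exists t c m C1 C2, cstep C (Time t) C1 /\ cstep C1 (Comm c m) C2.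

(* The head of the queue is the head of the sequence. *)
Definition qconfig : Type := (valuation X R * stype * seq msg)%type.

(* The transition relation of configurations with queues is stratified, since
   the rule for time has a negative premise on tau-transitions; these arise
   only from [qact_recv]. *)
Inductive qact : qconfig -> act_label -> qconfig -> Prop :=
| qact_send nu S M m nu' S' :
    cstep (nu, S) (Comm Send m) (nu', S') ->
    qact (nu, S, M) (Comm Send m) (nu', S', M)
| qact_recv nu S M m nu' S' :
    cstep (nu, S) (Comm Recv m) (nu', S') ->
    qact (nu, S, m :: M) Tau (nu', S', M)
| qact_que nu S M m :
    qact (nu, S, M) (Comm Recv m) (nu, S, rcons M m).

Inductive qstep : qconfig -> act_label -> qconfig -> Prop :=
| qstep_act C ell C' : qact C ell C' -> qstep C ell C'
| qstep_time nu S M t nu' S' :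
    cstep (nu, S) (Time t) (nu', S') ->
    (future_enabled (nu, S) -> future_enabled (nu', S')) ->
    (forall t' : {nonneg R}, t'%:num < t%:num ->
       ~ exists C', qact (delay nu t', S, M) Tau C') ->
    qstep (nu, S, M) (Time t) (nu', S', M).

Definition system : Type := (qconfig * qconfig)%type.

Inductive sstep : system -> act_label -> system -> Prop :=
| sstep_com_l C1 C2 C1' C2' m :
    qstep C1 (Comm Send m) C1' -> qstep C2 (Comm Recv m) C2' ->
    sstep (C1, C2) Tau (C1', C2')
| sstep_com_r C1 C2 C1' C2' m :
    qstep C1 (Comm Recv m) C1' -> qstep C2 (Comm Send m) C2' ->
    sstep (C1, C2) Tau (C1', C2')
| sstep_par_l C1 C2 C1' : qstep C1 Tau C1' -> sstep (C1, C2) Tau (C1', C2)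
| sstep_par_r C1 C2 C2' : qstep C2 Tau C2' -> sstep (C1, C2) Tau (C1, C2')
| sstep_wait C1 C2 C1' C2' t :
    qstep C1 (Time t) C1' -> qstep C2 (Time t) C2' ->
    sstep (C1, C2) (Time t) (C1', C2').

Definition reachable : system -> system -> Prop :=
  clos_refl_trans system (fun P Q => exists ell, sstep P ell Q).

Inductive unfolds_to_end : stype -> Prop :=
| unfolds_end : unfolds_to_end TEnd
| unfolds_rec a S :
    unfolds_to_end (subst a (TRec a S) S) -> unfolds_to_end (TRec a S).

Definition final (C : qconfig) : Prop :=
  unfolds_to_end C.1.2 /\ C.2 = [::].

Definition progress (P : system) : Prop :=
  forall C1 C2, reachable P (C1, C2) ->
    (final C1 /\ final C2) \/
    exists t Q Q', sstep (C1, C2) (Time t) Q /\ sstep Q Tau Q'.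

End Types.

Arguments TEnd {X L B}.
Arguments TVar {X L B} a.

(* Main.v *)
(* A message is sent only at an instant at which the dual party can receive it,
   and a party that can receive lets no time elapse and, by the mixed-choice
   condition, cannot send.  Hence every reachable system has an empty queue on
   one side, and the other party, by draining its own queue at the current
   instant, reaches the valuation and the dual type of its partner, both up to
   unfolding of recursion (a delay may unfold types).  When both queues are
   empty, the common type is well-formed against the common valuation, so it is
   [end] or some action becomes enabled for both parties after the same delay. *)
Require Import Defs.
From mathcomp Require Import boolp.

Set Implicit Arguments.
Unset Strict Implicit.
Unset Printing Implicit Defensive.

Import Order.TTheory GRing.Theory Num.Theory.
Local Open Scope ring_scope.

(** * Zero delays and finite disjunctions of constraints *)

Section Valuations.
Variables (X : finType) (R : realType).

Lemma delay0 (nu : valuation X R) (t : {nonneg R}) : t%:num = 0 ->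
  delay nu t = nu.
Proof. by move=> t0; apply: funext => x; apply/val_inj; rewrite /= t0 addr0. Qed.

Lemma sat_bigor (nu : valuation X R) n (d : 'I_n -> constr X) :
  sat nu (\big[@COr X/CFalse]_(i < n) d i) <-> exists i, sat nu (d i).
Proof.
elim: n d => [|n IH] d; first by rewrite big_ord0; split=> // -[[]].
rewrite big_ord_recl /= negb_and !negbK; split.
  case/orP=> [h|/IH[i h]]; first by exists ord0.
  by exists (lift ord0 i).
case=> i; case: (unliftP ord0 i) => [j|] -> h; apply/orP; last by left.
by right; apply/IH; exists j.
Qed.

End Valuations.

Section Progress.
Variables (R : realType) (X : finType) (L B : Type).
Local Notation stype := (stype X L B).
Local Notation env := (env X).
Local Notation valuation := (valuation X R).
Local Notation wf := (@wf X L B R).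
Local Notation wf_payload := (@wf_payload X L B R).
Local Notation msg := (msg X L B).
Local Notation cstep := (@cstep X L B R).
Local Notation Comm := (@Comm X L B R).
Local Notation Tau := (@Tau X L B R).
Local Notation Time := (@Time X L B R).
Local Notation config := (config X L B R).
Local Notation qconfig := (qconfig X L B R).

Implicit Types (S U N : stype) (A : env) (nu : valuation) (M : seq msg).

Scheme wf_mut := Minimality for Defs.wf Sort Prop
  with wf_payload_mut := Minimality for Defs.wf_payload Sort Prop.

(** * Substitution and unfolding of well-formed types *)

(** Free variables outside payloads are recorded in [A], and payloads are typed in the empty
    environment, hence closed; this second fact calls for the mutual induction. *)
Lemma wf_subst_id A d S : wf A d S ->
  forall a U, lookup A a = None -> subst a U S = S.
Proof.
move: A d S.
apply: (@wf_mut _ _ _ _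
  (fun A d S => forall a U, lookup A a = None -> subst a U S = S)
  (fun T => forall a U, subst_payload a U T = T)) => //=.
- move=> A d b S _ IH a U hA; case: eqP => // /eqP ba.
  by rewrite IH //= (negPf ba).
- move=> A d b hb a U ha; case: eqP => // ba.
  by move: hb; rewrite ba ha.
- move=> A past n c l T d lam S g _ _ IH _ _ _ IHT a U hA.
  congr TChoice; apply: funext => i; first exact: IHT.
  exact: IH.
- by move=> d S g _ IH _ a U; rewrite IH.
Qed.

Lemma wf_payload_subst T : wf_payload T -> forall a U, subst_payload a U T = T.
Proof. by case=> //= d S g hS _ a U; rewrite (wf_subst_id hS). Qed.

Lemma wf_weaken A d S : wf A d S -> forall A',
  (forall a e, lookup A a = Some e -> lookup A' a = Some e) -> wf A' d S.
Proof.
elim=> {A d S}.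
- by move=> A A' _; constructor.
- move=> A d a S _ IH A' hA; constructor; apply: IH => b e /=.
  by case: eqP => // _; apply: hA.
- by move=> A d a ha A' hA; constructor; apply: hA.
- move=> A past n c l T d lam S g hp _ IH hr hm hT A' hA.
  by apply: (wf_choice l hp _ hr) => // i; apply: IH.
Qed.

Lemma wf_guarded A d S : wf A d S -> forall a, lookup A a = None -> guarded a S.
Proof.
elim=> {A d S} //=.
- move=> A d b S _ IH a hA; case: eqP => //= /eqP ba.
  by apply: IH; rewrite /= (negPf ba).
- by move=> A d b hb a ha; apply/eqP => ba; move: hb; rewrite ba ha.
Qed.

(** [U] is closed, so weakening fits it into any environment and nothing is captured. [A'] has to
    extend [A] only away from [a], the variable that disappears. *)
Lemma wf_subst A d S : wf A d S -> forall A' a e U,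
  lookup A a = Some e -> wf [::] e U ->
  (forall b f, b != a -> lookup A b = Some f -> lookup A' b = Some f) ->
  wf A' d (subst a U S).
Proof.
elim=> {A d S} /=.
- by move=> *; constructor.
- move=> A d b S hS IH A' a e U ha hU hA; constructor.
  case: eqP => [ba|/eqP ba].
    (* The binder shadows [a]: the body stays as it is, and the inner binding hides the entry at
       which [A] and [A'] may differ. *)
    apply: (wf_weaken hS) => x f /=; case: eqP => // /eqP bx.
    by apply: hA; rewrite eq_sym -ba.
  apply: (IH _ _ e) => //=; first by rewrite (negPf ba).
  by move=> x f xa; case: eqP => // _; apply: hA.
- move=> A d b hb A' a e U ha hU hA; case: eqP => [ba|/eqP ba].
    by move: hb; rewrite ba ha => -[<-]; apply: (wf_weaken hU).
  by constructor; apply: hA.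
- move=> A past n c l T d lam S g hp _ IH hr hm hT A' a e U ha hU hA.
  apply: (wf_choice l hp _ hr) => // i; first exact: (IH i _ _ e).
  by rewrite wf_payload_subst.
Qed.

Lemma guarded_subst a U b S : guarded b U -> guarded b S ->
  guarded b (subst a U S).
Proof.
move=> hU; elim: S => //= [x|x S IH].
  by case: (x =P a).
by case/orP=> [->//|hS]; case: ifP => _; rewrite ?hS ?IH ?orbT.
Qed.

(** Contractivity survives because a closed [U] guards every variable, even where it replaces an
    occurrence of [a] that is not below a choice. *)
Lemma toast_subst A d S : wf A d S -> forall a e U,
  wf [::] e U -> toast U -> toast S -> toast (subst a U S).
Proof.
elim=> {A d S} //=.
- move=> A d b S _ IH a e U hU tU [gS tS].
  case: eqP => // _; split; last exact: IH hU tU tS.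
  by apply: guarded_subst gS; apply: (wf_guarded hU).
- by move=> A d b _ a e U _ tU _; case: eqP.
- move=> A past n c l T d lam S g _ _ IH _ _ hT a e U hU tU [il tT tS].
  split=> // i; first by rewrite wf_payload_subst.
  exact: IH hU tU (tS i).
Qed.

(* [subst] acts inside payloads and [dual] does not: the equation holds only
   because well-formed payloads are closed. *)
Lemma dual_subst A d S : wf A d S -> forall a U,
  dual (subst a U S) = subst a (dual U) (dual S).
Proof.
elim=> {A d S} //=.
- by move=> A d b S _ IH a U; case: eqP => // _; rewrite IH.
- by move=> A d b _ a U; case: eqP.
- move=> A past n c l T d lam S g _ _ IH _ _ hT a U.
  congr TChoice; apply: funext => i; last exact: IH.
  by rewrite !wf_payload_subst.
Qed.

Lemma dual_polK : involutive dual_pol.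
Proof. by case. Qed.

Lemma dualK : involutive (@dual X L B).
Proof.
move=> S; elim/stype_ind: S => //= [a S -> //|n c l T d lam S IH].
congr TChoice; apply: funext => i; [exact: dual_polK | exact: IH].
Qed.

Lemma toast_dual S : toast S -> toast (dual S).
Proof.
elim: S => //= [a S IH [gS tS]|n c l T d lam S IH [il tT tS]].
  split; last exact: IH.
  by elim: S gS {IH tS} => //= b S IH; case: eqP.
by split=> // i; apply: IH.
Qed.

Lemma wf_dual A d S : wf A d S -> wf A d (dual S).
Proof.
elim=> {A d S} /=; try by constructor.
move=> A past n c l T d lam S g hp _ IH hr hm hT.
apply: (wf_choice l hp IH hr) => // i j /hm[]; first by left.
by move=> ->; right.
Qed.

(** The measure for head unfolding: by contractivity the bound variable occurs only below choices,
    so an unfolding removes one leading binder and creates none. *)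
Fixpoint rec_depth S : nat :=
  if S is TRec _ S1 then (rec_depth S1).+1 else 0.

Lemma rec_depth_subst a U S : guarded a S ->
  rec_depth (subst a U S) = rec_depth S.
Proof.
elim: S => //= [b /negPf->//|b S IH].
by case: eqP => //= _ /IH->.
Qed.

Inductive unfolding : stype -> stype -> Prop :=
| unfolding_refl S : unfolding S S
| unfolding_rec a S S' :
    unfolding (subst a (TRec a S) S) S' -> unfolding (TRec a S) S'.

Definition is_head S : bool :=
  match S with TEnd | TChoice _ _ _ _ _ _ _ => true | _ => false end.

Lemma is_head_dual S : is_head (dual S) = is_head S.
Proof. by case: S. Qed.

(** Unfolding is deterministic and stops at a head form, so [N] lies beyond every intermediate
    type. *)
Lemma unfolding_head S S' N :
  unfolding S S' -> unfolding S N -> is_head N -> unfolding S' N.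
Proof.
elim=> // a S1 S2 _ IH hN headN; apply: IH => //.
by inversion hN; subst.
Qed.

(** Rule [wf_rec] gives a recursion and its body the same constraint, so [d] is kept by each
    unfolding; the dual side follows in lockstep by [dual_subst]. *)
Lemma wf_unfolds_to_head d S : wf [::] d S -> toast S ->
  exists N, [/\ unfolding S N, unfolding (dual S) (dual N), is_head N,
                wf [::] d N & toast N].
Proof.
have [k] := ubnP (rec_depth S); elim: k S => // k IH S.
case: S => [|a|a S|n c l T e lam S] hk hS tS.
- by exists TEnd; split=> //; apply: unfolding_refl.
- by exfalso; inversion hS.
- have hS1 : wf [:: (a, d)] d S by inversion hS.
  case: (tS) => gS tS1.
  have hU : wf [::] d (subst a (TRec a S) S).
    apply: (@wf_subst _ _ _ hS1 _ _ d) => //=; first by rewrite eqxx.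
    by move=> b f ba; rewrite eq_sym (negPf ba).
  have tU : toast (subst a (TRec a S) S) by apply: (toast_subst hS1 _ hS).
  have [|N [h1 h2 hN wN tN]] := IH _ _ hU tU.
    by rewrite rec_depth_subst.
  exists N; split=> //; first exact: unfolding_rec.
  by apply: unfolding_rec; move: h2; rewrite (dual_subst hS1).
- by exists (TChoice c l T e lam S); split=> //; apply: unfolding_refl.
Qed.

(** * Transitions up to unfolding *)

(** A delay may be derived through [cstep_unfold], hence its target type is known only up to
    [unfolding]. *)
Lemma cstep_inv (C : config) ell C' : cstep C ell C' ->
  match ell with
  | Defs.Comm p m =>
    match C.2 with
    | TChoice n c l T d lam S' =>
        exists j, [/\ sat C.1 (d j), p = c j, m = (l j, T j) &
                      C' = (reset (lam j) C.1, S' j)]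
    | TRec a S' => cstep (C.1, subst a (TRec a S') S') ell C'
    | _ => False
    end
  | Defs.Tau => False
  | Defs.Time t => exists2 S', C' = (delay C.1 t, S') & unfolding C.2 S'
  end.
Proof.
elim=> {C ell C'} [nu n c l T d lam S j hj|nu a S ell C' h IH|nu S t] /=.
- by exists j.
- case: ell h IH => //= t h [S' -> hS']; exists S' => //.
  exact: unfolding_rec.
- by exists S => //; apply: unfolding_refl.
Qed.

Lemma cstep_unfolding nu S S' p m C : unfolding S S' ->
  cstep (nu, S) (Comm p m) C <-> cstep (nu, S') (Comm p m) C.
Proof.
elim=> // a S1 S2 _ IH; split=> [/cstep_inv/= /IH //|/IH].
exact: cstep_unfold.
Qed.

Lemma future_enabled_unfolding nu S S' : unfolding S S' ->
  future_enabled (nu, S) <-> future_enabled (nu, S').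
Proof.
move=> hu; split=> -[t [c [m [C1 [C2 [/cstep_inv/=[S1 -> h1] h2]]]]]];
  exists t, c, m.
  exists (delay nu t, S'), C2; split; first exact: cstep_tick.
  by apply/(cstep_unfolding _ _ _ _ hu)/(cstep_unfolding _ _ _ _ h1).
exists (delay nu t, S), C2; split; first exact: cstep_tick.
by apply/(cstep_unfolding _ _ _ _ hu)/(cstep_unfolding _ _ _ _ h1).
Qed.

Lemma wf_choice_inv A past S : wf A past S ->
  if S is TChoice n c l T d lam S' then
    [/\ is_past R past (\big[@COr X/CFalse]_(i < n.+1) d i),
        forall i, exists2 g, wf A g (S' i) & reset_entails R (d i) (lam i) g &
        forall i j, i <> j -> entails R (CAnd (d i) (d j)) CFalse \/ c i = c j]
  else True.
Proof.
case=> // A' past' n c l T d lam S' g hp hS hr hm hT.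
by split=> // i; exists (g i).
Qed.

Lemma future_enabled_choice nu past n c l T d lam (S : 'I_n.+1 -> stype) :
  is_past R past (\big[@COr X/CFalse]_(i < n.+1) d i) ->
  future_enabled (nu, @TChoice X L B n c l T d lam S) <-> sat nu past.
Proof.
move=> hp; split.
  case=> t [p [m [C1 [C2 [/cstep_inv/=[S1 -> h1] h2]]]]].
  move/(cstep_unfolding _ _ _ _ h1): h2 => /cstep_inv/= [j [hj _ _ _]].
  by apply/hp; exists t; apply/sat_bigor; exists j.
case/hp=> t /sat_bigor[j hj].
exists t, (c j), (l j, T j), (delay nu t, TChoice c l T d lam S).
by exists (reset (lam j) (delay nu t), S j); split;
  [apply: cstep_tick | apply: cstep_act].
Qed.

(** * Synchronised and lagging parties *)

(** Passing through a common head form [N] makes duality independent of how far each side has been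
    unfolded. *)
Definition synced nu S1 S2 : Prop :=
  exists N d, [/\ unfolding S1 N, unfolding S2 (dual N), is_head N, toast N
                & wf [::] d N /\ sat nu d].

Lemma synced_dual nu S : toast S -> well_formed nu S -> synced nu S (dual S).
Proof.
move=> tS [d [wS hd]].
by have [N [h1 h2 hN wN tN]] := wf_unfolds_to_head wS tS; exists N, d.
Qed.

Lemma synced_sym nu S1 S2 : synced nu S1 S2 -> synced nu S2 S1.
Proof.
case=> N [d [h1 h2 hN tN [wN hd]]]; exists (dual N), d.
by split; rewrite ?dualK ?is_head_dual //;
  [apply: toast_dual | split=> //; apply: wf_dual].
Qed.

Lemma synced_unfolding nu S1 S2 S1' S2' : unfolding S1 S1' -> unfolding S2 S2' ->
  synced nu S1 S2 -> synced nu S1' S2'.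
Proof.
move=> u1 u2 [N [d [h1 h2 hN tN hd]]]; exists N, d.
by split=> //; [apply: unfolding_head u1 h1 _ | apply: unfolding_head u2 h2 _;
  rewrite is_head_dual].
Qed.

(** For a choice, satisfying [d] amounts to being future-enabled, so the premise of the time rule
    preserves well-formedness; for [TEnd] the constraint is [CTrue]. *)
Lemma synced_delay nu t S1 S2 : synced nu S1 S2 ->
  (future_enabled (nu, S1) -> future_enabled (delay nu t, S1)) ->
  synced (delay nu t) S1 S2.
Proof.
case=> N [d [h1 h2 hN tN [wN hd]]] hfe; exists N, d; split=> //; split=> //.
case: N hN h1 wN {h2 tN} => // [_ h1 wN|n c l T e lam S _ h1 wN].
  by inversion wN.
have [hp _ _] := wf_choice_inv wN.
apply/(future_enabled_choice _ c l T lam S hp).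
apply/(future_enabled_unfolding _ h1)/hfe/(future_enabled_unfolding _ h1).
exact/(future_enabled_choice _ c l T lam S hp).
Qed.

(** Other messages may be enabled as well, but only with polarity [p]; the result is determined once
    the message is [m]. *)
Definition forced nu S (p : polarity) (m : msg) (C : config) : Prop :=
  cstep (nu, S) (Comm p m) C /\
  forall p' m' C', cstep (nu, S) (Comm p' m') C' ->
    p' = p /\ (m' = m -> C' = C).

Lemma forced_unfolding nu S S' p m C : unfolding S S' ->
  forced nu S p m C -> forced nu S' p m C.
Proof.
move=> hu [h1 h2]; split; first exact/(cstep_unfolding _ _ _ _ hu).
by move=> p' m' C' /(cstep_unfolding _ _ _ _ hu)/h2.
Qed.

(** The partner takes the dual branch. Mixed choice fixes the polarity of all enabled branches,
    distinct labels fix the continuation, and feasibility makes it well-formed after the reset. *)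
Lemma synced_step nu S1 S2 p m nu' S1' : synced nu S1 S2 ->
  cstep (nu, S1) (Comm p m) (nu', S1') ->
  exists2 S2', forced nu S2 (dual_pol p) m (nu', S2') & synced nu' S1' S2'.
Proof.
case=> N [past [h1 h2 hN tN [wN hd]]] /(cstep_unfolding _ _ _ _ h1) /cstep_inv/=.
case: N hN h1 h2 tN wN => // n c l T d lam S _ h1 h2 [il _ tS] wN.
case=> j [hj -> -> [-> ->]].
have [_ hS hm] := wf_choice_inv wN.
exists (dual (S j)).
  split.
    by apply/(cstep_unfolding _ _ _ _ h2); apply: (@cstep_act X L B R).
  move=> p' m' C' /(cstep_unfolding _ _ _ _ h2) /cstep_inv/=.
  case=> i [hi -> -> ->]; split; last by case=> /il-> _.
  have [->//|/eqP ij] := eqVneq i j.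
  case: (hm i j ij) => [/(_ nu)/= hF|->//].
  by move: hF; rewrite hi hj => /(_ isT).
have [g wg hg] := hS j.
by apply: synced_dual; [apply: tS | exists g; split; [apply: wg | apply: hg]].
Qed.

Lemma synced_progress nu S1 S2 : synced nu S1 S2 ->
  (unfolds_to_end S1 /\ unfolds_to_end S2) \/
  exists t p m C, cstep (delay nu t, S1) (Comm p m) C.
Proof.
case=> N [past [h1 h2 hN tN [wN hd]]].
case: N hN h1 h2 tN wN => // [_ h1 h2 _ _|n c l T d lam S _ h1 h2 _ wN].
  have unfE S : unfolding S TEnd -> unfolds_to_end S.
    move eN : TEnd => N h; elim: h eN => [_ <-|a S0 S' _ IH /IH].
      exact: unfolds_end.
    exact: unfolds_rec.
  by left; split; apply: unfE.
right; have [hp _ _] := wf_choice_inv wN.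
have /hp[t /sat_bigor[j hj]] := hd.
exists t, (c j), (l j, T j), (reset (lam j) (delay nu t), S j).
by apply/(cstep_unfolding _ _ _ _ h1); apply: cstep_act.
Qed.

(* [lagging M nu S nu' S']: by receiving all of [M] at once, [(nu, S)] catches
   up with its partner [(nu', S')]. *)
Inductive lagging : seq msg -> valuation -> stype -> valuation -> stype -> Prop :=
| lagging_nil nu S S' : synced nu S S' -> lagging [::] nu S nu S'
| lagging_cons m M nu S nu1 S1 nu' S' :
    forced nu S Recv m (nu1, S1) -> lagging M nu1 S1 nu' S' ->
    lagging (m :: M) nu S nu' S'.

Lemma lagging_inv M nu S nu' S' : lagging M nu S nu' S' ->
  match M with
  | [::] => nu' = nu /\ synced nu S S'
  | m :: M1 => exists nu1 S1, forced nu S Recv m (nu1, S1) /\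
                              lagging M1 nu1 S1 nu' S'
  end.
Proof. by case=> // m M1 nu0 S0 nu1 S1 nu2 S2 h1 h2; exists nu1, S1. Qed.

(** The partner sends from the synchronised state at the end of [M], where the matching reception is
    forced and becomes the last one. *)
Lemma lagging_rcons M nu S nu' S' m nu2 S2 : lagging M nu S nu' S' ->
  cstep (nu', S') (Comm Send m) (nu2, S2) ->
  lagging (rcons M m) nu S nu2 S2.
Proof.
elim=> {M nu S nu' S'} [nu S S' /synced_sym hs h|].
  have [S1 hf hs1] := synced_step hs h.
  by apply: (lagging_cons hf); apply/lagging_nil/synced_sym.
by move=> m' M nu S nu1 S1 nu' S' hf _ IH /IH; apply: lagging_cons.
Qed.

Lemma lagging_unfolding M nu S nu' S' S1 S1' :
  unfolding S S1 -> unfolding S' S1' ->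
  lagging M nu S nu' S' -> lagging M nu S1 nu' S1'.
Proof.
move=> u u' h; elim: h S1 S1' u u' => {M nu S nu' S'}.
  move=> nu S S' hs S1 S1' u u'; apply: lagging_nil.
  exact: synced_unfolding hs.
move=> m M nu S nu1 S1 nu' S' hf _ IH S2 S2' u u'.
apply: (lagging_cons (forced_unfolding u hf)).
by apply: IH => //; apply: unfolding_refl.
Qed.

(** * Alignment as an invariant of reachable systems *)

Lemma qstep_inv (C : qconfig) ell C' : qstep C ell C' ->
  match ell with
  | Defs.Comm Send m => exists nu S,
      cstep C.1 (Comm Send m) (nu, S) /\ C' = (nu, S, C.2)
  | Defs.Comm Recv m => C' = (C.1, rcons C.2 m)
  | Defs.Tau => exists m M nu S,
      [/\ C.2 = m :: M, cstep C.1 (Comm Recv m) (nu, S) & C' = (nu, S, M)]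
  | Defs.Time t => exists S',
      [/\ C' = (delay C.1.1 t, S', C.2), unfolding C.1.2 S',
        future_enabled C.1 -> future_enabled (delay C.1.1 t, S') &
        forall t' : {nonneg R}, t'%:num < t%:num ->
          ~ exists C', qact (delay C.1.1 t', C.1.2, C.2) Tau C']
  end.
Proof.
case=> {C ell C'} [C ell C' []|nu S M t nu' S' /cstep_inv/= [S1 [-> ->] hu] hf hq].
- by move=> nu S M m nu' S' h; exists nu', S'.
- by move=> nu S M m nu' S' h; exists m, M, nu', S'.
- by [].
- by exists S1.
Qed.

Definition ahead (C1 C2 : qconfig) : Prop :=
  C1.2 = [::] /\ lagging C2.2 C2.1.1 C2.1.2 C1.1.1 C1.1.2.

Definition aligned (P : system X L B R) : Prop :=
  ahead P.1 P.2 \/ ahead P.2 P.1.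

Lemma sstep_swap (P Q : system X L B R) ell :
  sstep P ell Q -> sstep (P.2, P.1) ell (Q.2, Q.1).
Proof.
case=> /=.
- by move=> *; apply: sstep_com_r; eassumption.
- by move=> *; apply: sstep_com_l; eassumption.
- by move=> *; apply: sstep_par_r.
- by move=> *; apply: sstep_par_l.
- by move=> *; apply: sstep_wait.
Qed.

Lemma ahead_sstep (P Q : system X L B R) ell :
  sstep P ell Q -> ahead P.1 P.2 -> aligned Q.
Proof.
case=> {P ell Q} /= [C1 C2 C1' C2' m|C1 C2 C1' C2' m|C1 C2 C1'|C1 C2 C2'|
  C1 C2 C1' C2' t].
- case/qstep_inv=> nu [S [h ->]] /qstep_inv-> [e1 hl]; left; split=> //=.
  by apply: lagging_rcons hl _; move: h; case: C1.1.
- move=> /qstep_inv-> /qstep_inv[nu [S [h ->]]] [e1 hl]; right.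
  case: C2 h hl => [[nu2 S2] [|m' M]] /= h /lagging_inv.
    (* With its queue drained, [C2] is synchronised with [C1]; its send makes it the party ahead. *)
    case=> enu hs; split=> //=; rewrite e1 enu.
    by apply: (@lagging_rcons [::]) h; apply/lagging_nil/synced_sym.
  (* A pending message forces polarity [Recv], so [C2] cannot send. *)
  by case=> nu1 [S1 [[_ /(_ _ _ _ h)[]]]].
- by case/qstep_inv=> m [M [nu [S [e _ _]]]] []; rewrite e.
- case/qstep_inv=> m [M [nu [S [e2 h ->]]]] [e1].
  rewrite e2 => /lagging_inv[nu1 [S1 [[_ hf] hl]]].
  left; split=> //=.
  case: C2 e2 h hf => [[nu2 S2] M2] /= _ h hf.
  (* The message received is the forced one, so the result is the next state of the lagging
     chain. *)
  by have [_ /(_ erefl)[-> ->]] := hf _ _ _ h.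
- case/qstep_inv=> S1 [-> u1 f1 q1] /qstep_inv[S2 [-> u2 f2 q2]] [e1 hl].
  left; split=> //=.
  apply: (lagging_unfolding u2 u1).
  case: C2 hl u2 f2 q2 => [[nu2 T2] [|m M]] /= /lagging_inv.
    case=> -> hs u2 f2 _; apply/lagging_nil/synced_delay => // /f2.
    by move/(future_enabled_unfolding _ u2).
  case=> nu1 [T1 [[h hf] hl]] u2 _ q2.
  (* a receivable message forbids any positive delay *)
  have t0 : t%:num = 0.
    apply/eqP; rewrite eq_le ge0 andbT leNgt; apply/negP => t_gt0.
    apply: (q2 0%:nng); first by [].
    by exists (nu1, T1, M); rewrite delay0 //; apply: qact_recv.
  by rewrite !delay0 //; apply: lagging_cons hl.
Qed.

Lemma aligned_sstep (P Q : system X L B R) ell :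
  sstep P ell Q -> aligned P -> aligned Q.
Proof.
move=> h [hP|hP]; first exact: ahead_sstep h hP.
by case: (ahead_sstep (sstep_swap h) hP); [right | left].
Qed.

Lemma aligned_reachable (P Q : system X L B R) :
  reachable P Q -> aligned P -> aligned Q.
Proof. by elim=> [x y [ell /aligned_sstep]|//|x y z _ IH1 _ IH2 /IH1/IH2]. Qed.

(** * Progress of aligned systems *)

Definition progresses (P : system X L B R) : Prop :=
  (final P.1 /\ final P.2) \/
  exists t Q Q', sstep P (Time t) Q /\ sstep Q Tau Q'.

Lemma progresses_swap (P : system X L B R) :
  progresses P -> progresses (P.2, P.1).
Proof.
case=> [[h1 h2]|[t [Q [Q' [h1 h2]]]]]; [by left | right].
by exists t, (Q.2, Q.1), (Q'.2, Q'.1); split; apply: sstep_swap.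
Qed.

Lemma qstep_time0 (C : qconfig) : qstep C (Time 0%:nng) C.
Proof.
case: C => [[nu S] M].
have e : delay nu 0%:nng = nu by rewrite delay0.
apply: qstep_time => //; first by rewrite -{2}e; apply: cstep_tick.
by move=> t' /=; rewrite ltNge ge0.
Qed.

(** An empty queue excludes internal steps, and the action enabled after [t] shows
    future-enabledness with zero further delay. *)
Lemma qstep_delay_empty nu S t p m C :
  cstep (delay nu t, S) (Comm p m) C ->
  qstep (nu, S, [::]) (Time t) (delay nu t, S, [::]).
Proof.
move=> h; apply: qstep_time; first exact: cstep_tick.
  move=> _; exists 0%:nng, p, m, (delay nu t, S), C; split=> //.
  by rewrite -{2}(@delay0 _ _ (delay nu t) 0%:nng) //; apply: cstep_tick.
by move=> t' _ [C' /qstep_act/qstep_inv[? [? [? [? []]]]]].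
Qed.

Lemma ahead_progresses (C1 C2 : qconfig) : ahead C1 C2 -> progresses (C1, C2).
Proof.
case: C1 C2 => [[nu1 S1] M1] [[nu2 S2] M2] [/= -> /lagging_inv].
case: M2 => [[-> hs]|m M [nu [S [[h _] _]]]]; last first.
  (* The head of a nonempty queue can be received now, after the zero delay that is always
     allowed. *)
  right; exists 0%:nng, (nu1, S1, [::], (nu2, S2, m :: M)).
  exists (nu1, S1, [::], (nu, S, M)); split.
    by apply: sstep_wait; apply: qstep_time0.
  exact/sstep_par_r/qstep_act/qact_recv.
have [[e2 e1]|[t [p [m [[nu S] h]]]]] := synced_progress hs; [by left|right].
(* Synchrony persists because an action is enabled at [t]; it then yields the dual action of the
   partner. *)
have hst : synced (delay nu2 t) S2 S1.
  apply: synced_delay => // _; exists 0%:nng, p, m, (delay nu2 t, S2), (nu, S).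
  by split=> //; rewrite -{2}(@delay0 _ _ (delay nu2 t) 0%:nng) //;
    apply: cstep_tick.
have [S' [h' _] _] := synced_step hst h.
exists t, (delay nu2 t, S1, [::], (delay nu2 t, S2, [::])).
(* [p] is the polarity of [C2]. In both cases only the sender changes its type; the message merely
   enters the queue of the receiver. *)
case: p h h' => h h'.
  exists (delay nu2 t, S1, [:: m], (nu, S, [::])); split.
    by apply: sstep_wait;
      [apply: qstep_delay_empty h' | apply: qstep_delay_empty h].
  apply: (@sstep_com_r _ _ _ _ _ _ _ _ m); apply: qstep_act.
    exact: (@qact_que _ _ _ _ _ _ [::]).
  exact: qact_send.
exists (nu, S', [::], (delay nu2 t, S2, [:: m])); split.
  by apply: sstep_wait;
    [apply: qstep_delay_empty h' | apply: qstep_delay_empty h].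
apply: (@sstep_com_l _ _ _ _ _ _ _ _ m); apply: qstep_act.
  exact: qact_send.
exact: (@qact_que _ _ _ _ _ _ [::]).
Qed.

End Progress.

Theorem theorem2p8 (R : realType) (X : finType) (L B : Type)
  (S : stype X L B) (hS : toast S) (hwf : well_formed (@nu0 X R) S) :
  progress ((@nu0 X R, S, [::]), (@nu0 X R, dual S, [::])).
Proof.
move=> C1 C2 /aligned_reachable reach.
have [|h|h] := reach; last exact: progresses_swap (ahead_progresses h).
  by left; split=> //=; apply/lagging_nil/synced_sym/synced_dual.
exact: ahead_progresses h.
Qed.
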